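(* Let $(X,\|\cdot\|)$ be a Banach space, $C\subseteq X$ a closed convex set, and $T:C\to C$ a nonexpansive map. Let $(\alpha_n)_{n\ge 1}$ be a sequence in $[0,1]$, $(e_n)_{n\ge 1}$ a sequence in $X$, $x_0\in C$, and let $(x_n)_{n\in\mathbb{N}}$ be a sequence in $C$ generated by $$x_{n+1}=(1-\alpha_{n+1})\,x_n+\alpha_{n+1}\,(Tx_n+e_{n+1}),\qquad n\in\mathbb{N}.$$ Suppose that $\|x_n-Tx_n\|\to0$ and $\sum_{k\ge1}\alpha_k\|e_k\|<\infty$. (a) If $T(C)$ is relatively compact, then $x_n$ converges strongly to a fixed point of $T$. (b) If $X$ is uniformly convex and $(x_n)$ remains bounded, then $\mathrm{Fix}(T)\ne\emptyset$. Moreover, if in addition $X$ satisfies Opial's property, then $x_n$ converges weakly to a fixed point of $T$.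
   Context: $\mathbb{N}=\{0,1,2,\dots\}$. $T$ nonexpansive means $\|Tx-Ty\|\le\|x-y\|$ for all $x,y$ in its domain. $\mathrm{Fix}(T)=\{x: Tx=x\}$. $X$ has Opial's property if for every weakly convergent sequence $u_n\rightharpoonup u$ in $X$ one has $\liminf_{n\to\infty}\|u_n-u\|<\liminf_{n\to\infty}\|u_n-y\|$ for all $y\ne u$. *)

(* Defs.v *)
From HB Require Import structures.
From mathcomp Require Import all_boot all_order all_algebra.
From mathcomp Require Import all_classical all_reals all_analysis.

Set Implicit Arguments.
Unset Strict Implicit.
Unset Printing Implicit Defensive.

Import Order.TTheory GRing.Theory Num.Theory.
Import numFieldNormedType.Exports.

Local Open Scope classical_set_scope.
Local Open Scope ring_scope.

Definition fix_points (X : Type) (C : set X) (T : X -> X) : set X :=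
  [set p | C p /\ T p = p].

Definition weak_cvg (R : realType) (X : normedModType R)
    (u : nat -> X) (l : X) : Prop :=
  forall f : {linear X -> R^o}, continuous f ->
    f (u n) @[n --> \oo] --> f l.

(* Equivalently, the modulus of convexity
   inf {1 - |(x + y) / 2| : |x| <= 1, |y| <= 1, |x - y| >= eps}
   is positive for every eps in ]0, 2]; for eps > 2 the condition is vacuous. *)
Definition uniformly_convex (R : realType) (X : normedModType R) : Prop :=
  forall eps : R, 0 < eps ->
    exists2 delta : R, 0 < delta &
      forall x y : X, `|x| <= 1 -> `|y| <= 1 -> eps <= `|x - y| ->
        `|2^-1 *: (x + y)| <= 1 - delta.

(* The inferior limits are taken in the extended reals, so that they are
   meaningful without first knowing that u is bounded. *)
Definition opial (R : realType) (X : normedModType R) : Prop :=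
  forall (u : nat -> X) (v : X), weak_cvg u v ->
    forall y : X, y <> v ->
      (limn_einf (fun n => (`|u n - v|)%:E)
         < limn_einf (fun n => (`|u n - y|)%:E))%E.

(* Main.v *)
Require Import Defs.
From HB Require Import structures.
From mathcomp Require Import all_boot all_order all_algebra.
From mathcomp Require Import all_classical all_reals all_analysis.
From mathcomp Require Import lra.

Set Implicit Arguments.
Unset Strict Implicit.
Unset Printing Implicit Defensive.

Import Order.TTheory GRing.Theory Num.Theory.
Import numFieldNormedType.Exports.

Local Open Scope classical_set_scope.
Local Open Scope ring_scope.

(** The two facts behind every claim concern the sequence itself.  If [p] is a
    fixed point of [T], the recursion gives
    [|x (n+1) - p| <= |x n - p| + alpha (n+1) * |e (n+1)|], so that [|x n - p|]
    converges ([krasnoselskii_mann_fejer]); and since [|x n - T (x n)|] tends to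
    [0], for every [p] in [C] the distance of [x n] to [T p] is eventually at
    most its distance to [p], up to an arbitrarily small error
    ([near_residual]).

    If [T @` C] is precompact, [T (x n)] has a cluster point, which is then also
    a cluster point of [x n] and a fixed point of [T]; the distance from [x n]
    to it converges and is frequently small, so it tends to [0].

    If [X] is uniformly convex and [x] is bounded, [x] has exactly one asymptotic
    center [c] in [C] ([asymptotic_center]).  By [near_residual], [T c] is at
    least as good a center as [c], hence [T c = c].

    For weak convergence one needs that bounded sequences have weakly convergent
    subsequences.  This is obtained from uniform convexity alone, with neither
    the Hahn-Banach theorem nor reflexivity.  Given a proper filter [F]
    containing a bounded set, the elements of almost minimal norm in the closed
    convex members of [F] generate a Cauchy filter, whose limit lies in all of
    these members ([uniformly_convex_filter]); applied to the half-spaces, this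
    yields weak limits along ultrafilters.  To pass to subsequences, one uses a
    countable family of functionals which separates the weakly distinguishable
    points of a separable closed convex set containing the sequence: a
    subsequence along which the functionals of this family converge has a single
    weak cluster point ([uniformly_convex_weak_subsequence]).  Opial's property
    then shows that every weak limit of a subsequence of [x] is a fixed point,
    and that two such limits [p] and [q] cannot differ, because [|x n - p|] and
    [|x n - q|] both converge ([opial_demiclosed], [opial_lt]). *)

(** * Uniform convexity and closed convex sets *)

(** Stability under midpoints.  For closed sets this is the same as convexity,
    and it is the only form of convexity that the arguments below use. *)
Definition midconvex (R : realType) (X : normedModType R) (D : set X) : Prop :=
  forall y z, D y -> D z -> D (2^-1 *: (y + z)).

Lemma convex_set_midconvex (R : realType) (X : normedModType R) (C : set X) :
  convex_set (C : set (convex_lmodType X)) -> midconvex C.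
Proof.
move=> cC y z Cy Cz.
have h0 : (0 : R) <= 2^-1 by lra.
have h1 : (2^-1 : R) <= 1 by lra.
have /set_mem := cC y z (Itv01 h0 h1) (mem_set Cy) (mem_set Cz).
rewrite -[X in C X]/(2^-1 *: y + (1 - 2^-1) *: z).
by rewrite (_ : 1 - 2^-1 = 2^-1 :> R) ?scalerDr//; lra.
Qed.

Lemma midconvexI (R : realType) (X : normedModType R) (D E : set X) :
  midconvex D -> midconvex E -> midconvex (D `&` E).
Proof. by move=> cD cE y z [Dy Ey] [Dz Ez]; split; [exact: cD|exact: cE]. Qed.

(** Uniform convexity for balls of any center and radius.  The gain [delta] is
    uniform in the center [a] and in the radius [s <= M]. *)
Lemma uniformly_convex_ball (R : realType) (X : normedModType R) (M eps : R) :
  uniformly_convex X -> 0 < eps ->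
  exists2 delta, 0 < delta & forall (a y z : X) (s : R),
    `|a - y| <= s -> `|a - z| <= s -> s <= M -> eps <= `|y - z| ->
    `|a - 2^-1 *: (y + z)| <= s - delta.
Proof.
move=> ucX eps0.
pose M' := Num.max M 1.
have M'0 : 0 < M' by rewrite lt_max ltr01 orbT.
have [d d0 Hd] := ucX (eps / M') (divr_gt0 eps0 M'0).
exists (d * (eps / 2)); first by rewrite mulr_gt0// divr_gt0.
move=> a y z s ay az sM yz.
(* A ball of radius [s] contains points at distance [eps] only if
   [eps / 2 <= s]; this makes the gain [d * s] of the rescaled estimate uniform. *)
have s_ge : eps / 2 <= s.
  have : `|y - z| <= s + s.
    rewrite (_ : y - z = (a - z) - (a - y)).
      by rewrite (le_trans (ler_normB _ _))// lerD.
    by rewrite opprB [RHS]addrC addrA subrK.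
  lra.
have s0 : 0 < s by lra.
have sM' : s <= M' by rewrite le_max sM.
pose y' := s^-1 *: (a - y); pose z' := s^-1 *: (a - z).
have Hn (w : X) : `|w| <= s -> `|s^-1 *: w| <= 1.
  by move=> ws; rewrite normrZ gtr0_norm ?invr_gt0// mulrC ler_pdivrMr// mul1r.
have yz' : eps / M' <= `|y' - z'|.
  rewrite /y' /z' -scalerBr normrZ gtr0_norm ?invr_gt0//.
  rewrite (_ : a - y - (a - z) = z - y); last first.
    by rewrite opprB addrC addrA subrK.
  rewrite distrC mulrC ler_pM// ?invr_ge0; [exact: ltW|exact: ltW|].
  by rewrite lef_pV2.
have := Hd y' z' (Hn _ ay) (Hn _ az) yz'.
rewrite /y' /z' -scalerDr scalerA mulrC -scalerA.
rewrite (_ : 2^-1 *: (a - y + (a - z)) = a - 2^-1 *: (y + z)); last first.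
  rewrite addrACA -opprD scalerBr; congr (_ - _).
  by rewrite scalerDr -scalerDl (_ : 2^-1 + 2^-1 = 1 :> R) ?scale1r//; lra.
rewrite normrZ gtr0_norm ?invr_gt0// mulrC ler_pdivrMr// => /le_trans; apply.
have : d * (eps / 2) <= d * s by rewrite ler_pM2l.
lra.
Qed.

(** A quantitative form of weak compactness of bounded closed convex sets: the
    closed convex members of a filter with a bounded member have a common
    point, namely the limit of their points of minimal norm. *)
Lemma uniformly_convex_filter (R : realType) (X : completeNormedModType R)
    (F : set_system X) (M : R) :
  uniformly_convex X -> ProperFilter F -> F [set y | `|y| <= M] ->
  exists p, forall D, closed D -> midconvex D -> F D -> D p.
Proof.
move=> ucX FF FM.
pose CF (D : set X) := [/\ closed D, midconvex D & F D].
have CFI D E : CF D -> CF E -> CF (D `&` E).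
  move=> [cD mD FD] [cE mE FE]; split; [exact: closedI|exact: midconvexI|].
  exact: filterI.
(* [m] is the supremum over the closed convex members of [F] of the distance
   to the origin. *)
pose E : set R := [set s | exists2 D, CF D & forall y, D y -> s <= `|y|].
have E0 : E 0.
  by exists setT => //; split => //; exact: filterT.
have EM : has_ubound E.
  exists M => s [D [_ _ FD] Ds].
  by have [y [Dy yM]] := filter_ex (filterI FD FM); exact: le_trans (Ds _ Dy) yM.
have supE : has_sup E by split=> //; exists 0.
pose m := sup E.
pose G (Dd : set X * R) : set X := [set y | Dd.1 y /\ `|y| <= m + Dd.2].
pose I : set (set X * R) := [set Dd | CF Dd.1 /\ 0 < Dd.2].
have G_ex Dd : I Dd -> G Dd !=set0.
  move=> [CD d0]; apply: contrapT => Gn.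
  suff /(ub_le_sup EM) : E (m + Dd.2) by rewrite -/m; lra.
  exists Dd.1 => // y Dy; rewrite leNgt; apply/negP => /ltW ym.
  by apply: Gn; exists y.
have GF : ProperFilter (filter_from I G).
  apply: filter_from_proper => //; apply: filter_from_filter.
    exists (setT, 1); split => //.
    by split => //; exact: filterT.
  move=> [D d] [D' d'] [CD /= d0] [CD' /= d0'].
  exists (D `&` D', Num.min d d') => //=.
    by split => /=; [exact: CFI|rewrite lt_min d0 d0'].
  move=> y [/= [Dy D'y]]; rewrite -lerBlDl le_min !lerBlDl => /andP[yd yd'].
  by split; split.
have /cvg_ex[p Gp] : cvg (filter_from I G).
  apply/cauchy_cvgP/cauchy_exP => eps eps0.
  (* Two points of [D] with norm at most [m + d'] whose distance is at least
     [eps] would have a midpoint of norm less than [m - d'], which the choice of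
     [D] excludes. *)
  have [d d0 Hd] := uniformly_convex_ball (m + 1) ucX eps0.
  pose d' := Num.min (d / 4) 1.
  have d'0 : 0 < d' by rewrite lt_min divr_gt0/=.
  have d'd : d' <= d / 4 by rewrite ge_min lexx.
  have d'1 : d' <= 1 by rewrite ge_min lexx orbT.
  have [s [D CD Ds] ms] := sup_adherent d'0 supE.
  have ID : I (D, d') by [].
  have [y [Dy ym]] := G_ex _ ID.
  exists y; exists (D, d') => // z [Dz zm].
  rewrite -ball_normE /=; apply: contrapT => /negP; rewrite -leNgt => yz.
  have := Hd 0 y z (m + d'); rewrite !sub0r !normrN => /(_ ym zm _ yz).
  rewrite lerD2l => /(_ d'1).
  have [_ mD _] := CD.
  have := Ds _ (mD _ _ Dy Dz).
  move: ms; rewrite -/m; lra.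
exists p => D cD mD FD.
apply: (@closed_cvg _ _ _ GF id D cD _ p Gp).
by exists (D, 1) => // y [].
Qed.

(** * Asymptotic centers *)

(** Existence and uniqueness of the asymptotic center: [c] minimizes
    [limsup |x n - y|] over [y] in [C], and is the only minimizer.  The
    conclusion says that no other point [y] of [C] is as good as [c]. *)
Lemma asymptotic_center (R : realType) (X : completeNormedModType R)
    (C : set X) (x : nat -> X) (M : R) :
  uniformly_convex X -> closed C -> midconvex C -> C !=set0 ->
  (forall n, `|x n| <= M) ->
  exists2 c, C c & forall y, C y ->
    (forall eta : R, 0 < eta ->
       \forall n \near \oo, `|x n - y| <= `|x n - c| + eta) ->
    y = c.
Proof.
move=> ucX cC mC [z Cz] xM.
(* [S s] is the set of the points [y] of [C] with [limsup |x n - y| <= s]. *)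
pose S s : set X := [set y | C y /\
  forall eta : R, 0 < eta -> \forall n \near \oo, `|x n - y| <= s + eta].
have Scl s : closed (S s).
  move=> y ySs; split.
    by apply: cC => B /ySs[w [[Cw _] Bw]]; exists w.
  move=> eta eta0; have e2 : 0 < eta / 2 by rewrite divr_gt0.
  have [w [[_ Sw]]] := ySs _ (nbhsx_ballx y (eta / 2) e2).
  rewrite -ball_normE /= => yw.
  have := Sw (eta / 2) e2; apply: filterS => n xw.
  rewrite (le_trans (ler_distD w _ _))//.
  by rewrite distrC in yw; lra.
have Smid s : midconvex (S s).
  move=> y w [Cy Sy] [Cw Sw]; split; first exact: mC.
  move=> eta eta0; near=> n.
  have yn : `|x n - y| <= s + eta by near: n; exact: Sy.
  have wn : `|x n - w| <= s + eta by near: n; exact: Sw.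
  rewrite (_ : x n - _ = 2^-1 *: ((x n - y) + (x n - w))); last first.
    rewrite [in RHS]addrACA -opprD scalerBr; congr (_ - _).
    by rewrite scalerDr -scalerDl (_ : 2^-1 + 2^-1 = 1 :> R) ?scale1r//; lra.
  rewrite normrZ gtr0_norm ?invr_gt0// ler_pdivrMl//.
  rewrite (le_trans (ler_normD _ _))//; lra.
pose E : set R := [set s | S s !=set0].
have Elb : lbound E 0.
  move=> s [y [_ Sy]]; apply/ler_addgt0Pr => eta eta0.
  have [n xn] := filter_ex (Sy _ eta0).
  exact: le_trans xn.
have infE : has_inf E.
  split; last by exists 0.
  exists (M + `|z|); exists z; split => // eta eta0; near=> n.
  by rewrite (le_trans (ler_normB _ _))// -addrA lerD// lerDl ltW.
pose r := inf E.
have Smono s t : s <= t -> S s `<=` S t.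
  move=> st y [Cy Sy]; split => // eta /Sy; apply: filterS => n /le_trans; apply.
  by rewrite lerD2r.
have S_ex eps : 0 < eps -> S (r + eps) !=set0.
  move=> eps0; have [s [y Sy] sr] := inf_adherent eps0 infE.
  by exists y; apply: Smono Sy; exact: ltW.
(* The sublevel sets above the infimum [r] generate a filter of closed convex
   sets, so they have a common point. *)
pose FS : set_system X :=
  filter_from [set eps : R | 0 < eps] (fun eps => S (r + eps)).
have FF : ProperFilter FS.
  apply: filter_from_proper; last exact: S_ex.
  apply: filter_from_filter; first by exists 1; rewrite /=.
  move=> i j /= i0 j0; exists (Num.min i j); first by rewrite /= lt_min i0.
  move=> y Sy; split; apply: Smono Sy; rewrite lerD2l ge_min lexx ?orbT//.
have FM : FS [set y | `|y| <= M + (r + 1 + 1)].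
  exists 1 => //= y [_ /(_ _ ltr01) Sy].
  have [n xn] := filter_ex Sy.
  rewrite /= -(subKr (x n) y) (le_trans (ler_normB _ _))// lerD//.
have [c Hc] := uniformly_convex_filter ucX FF FM.
have Sc : S r c.
  have Sre eps : 0 < eps -> S (r + eps) c.
    by move=> eps0; apply: Hc => //; exists eps.
  split; first by have [] := Sre _ ltr01.
  move=> eta eta0; have e2 : 0 < eta / 2 by rewrite divr_gt0.
  have [_ /(_ _ e2)] := Sre _ e2; apply: filterS => n.
  by rewrite -addrA -splitr.
exists c; first exact: Sc.1.
move=> y Cy yc; apply: contrapT => /eqP; rewrite -subr_eq0 -normr_gt0 => yc0.
have Sy : S r y.
  split=> // eta eta0; have e2 : 0 < eta / 2 by rewrite divr_gt0.
  have := Sc.2 _ e2; have := yc _ e2; apply: filterS2 => n /= xc xy; lra.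
(* If [y] and [c] were distinct minimizers, their midpoint would lie in
   [S (r - d / 4)]. *)
have [d d0 Hd] := uniformly_convex_ball (r + 1) ucX yc0.
pose eta := Num.min (d / 4) 1.
have eta0 : 0 < eta by rewrite lt_min divr_gt0/=.
have etad : eta <= d / 4 by rewrite ge_min lexx.
have eta1 : eta <= 1 by rewrite ge_min lexx orbT.
suff ErN : E (r - d / 4) by move: (ge_inf infE.2 ErN); rewrite -/r => rle; lra.
exists (2^-1 *: (y + c)); split; first exact: mC Sc.1.
move=> e e0; have := Sc.2 _ eta0; have := Sy.2 _ eta0.
apply: filterS2 => n yn cn.
have := Hd (x n) y c _ yn cn; rewrite lerD2l => /(_ eta1 (lexx _)); lra.
Unshelve. all: by end_near. Qed.

(** * Quasi-Fejer monotone sequences *)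

(** A nonnegative sequence which increases by at most the terms of a convergent
    series converges: subtracting the partial sums makes it nonincreasing. *)
Lemma quasi_fejer_cvg (R : realType) (a b : nat -> R) :
  (forall n, 0 <= a n) -> (forall n, 0 <= b n.+1) ->
  (forall n, a n.+1 <= a n + b n.+1) ->
  (\sum_(1 <= k <oo) (b k)%:E < +oo)%E -> cvgn a.
Proof.
move=> a0 b0 ab bfin.
pose B n := \sum_(1 <= k < n.+1) b k.
have BS n : B n.+1 = B n + b n.+1 by rewrite /B big_nat_recr.
have bE0 n : (1 <= n)%N -> (0 <= (b n)%:E)%E.
  by case: n => // n _; rewrite lee_fin.
have [S BS'] : exists S, forall n, B n <= S.
  exists (fine (\sum_(1 <= k <oo) (b k)%:E)%E) => n.
  rewrite -lee_fin fineK; last first.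
    rewrite ge0_fin_numE//; apply: nneseries_ge0 => k k1 _; exact: bE0.
  rewrite /B -sumEFin.
  apply: nneseries_lim_ge => k k1 _; exact: bE0.
have Bcvg : cvgn B.
  apply: nondecreasing_is_cvgn.
    by apply/nondecreasing_seqP => n; rewrite BS lerDl.
  by exists S => _ [n _ <-].
have aBcvg : cvgn (a - B).
  apply: nonincreasing_is_cvgn.
    apply/nonincreasing_seqP => n; rewrite !fctE BS; have := ab n; lra.
  exists (- S) => _ [n _ <-]; rewrite !fctE.
  have := a0 n; have := BS' n; lra.
rewrite (_ : a = (a - B) + B); last by rewrite subrK.
exact: is_cvgD.
Qed.

(** * Weak limits along ultrafilters *)

Lemma midconvex_preimage (R : realType) (X Y : normedModType R)
    (f : {linear X -> Y}) (D : set Y) : midconvex D -> midconvex (f @^-1` D).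
Proof.
by move=> mD y z /= Dy Dz; rewrite linearZ/= linearD; exact: mD.
Qed.

Lemma midconvex_le (R : realType) (a : R) : @midconvex R R^o [set t | t <= a].
Proof. by move=> s t /= sa ta; rewrite -[_ *: _]/(2^-1 * (s + t)); lra. Qed.

Lemma midconvex_ge (R : realType) (a : R) : @midconvex R R^o [set t | a <= t].
Proof. by move=> s t /= sa ta; rewrite -[_ *: _]/(2^-1 * (s + t)); lra. Qed.

(** In a uniformly convex Banach space a bounded family converges weakly along
    every ultrafilter [U], to a common point of the closed convex sets which
    belong to the image of [U].  Indeed, as [U] is an ultrafilter, a closed
    half-space which does not contain this point has its complement in the
    image of [U]. *)
Lemma uniformly_convex_ultra_weak_cvg (R : realType)
    (X : completeNormedModType R) (I : Type) (U : set_system I) (u : I -> X)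
    (M : R) :
  uniformly_convex X -> UltraFilter U -> (forall i, `|u i| <= M) ->
  exists2 p, (forall D, closed D -> midconvex D -> (forall i, D (u i)) -> D p) &
    forall f : {linear X -> R^o}, continuous f -> f (u i) @[i --> U] --> f p.
Proof.
move=> ucX UU uM.
have [|p Hp] := @uniformly_convex_filter _ _ (u @ U) M ucX _.
  by apply: nearW => i /=.
exists p => [D cD mD Du|f cf].
  by apply: Hp => //; apply: nearW => i /=.
have key (A : set R^o) : closed A -> midconvex A ->
    ~ A (f p) -> \forall i \near U, ~ A (f (u i)).
  move=> cA mA nAfp.
  have [UA|//] := in_ultra_setVsetC [set i | A (f (u i))] UU.
  exfalso; apply: nAfp; apply: (Hp (f @^-1` A)) => //.
  - by have /continuous_closedP := cf; exact.
  - exact: midconvex_preimage.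
apply/cvgrPdist_lt => e e0.
have h1 : \forall i \near U, ~ (f p + e <= f (u i)).
  apply: (key [set t | f p + e <= t]) => //.
  - exact: midconvex_ge.
  - by rewrite /=; lra.
have h2 : \forall i \near U, ~ (f (u i) <= f p - e).
  apply: (key [set t | t <= f p - e]) => //.
  - exact: midconvex_le.
  - by rewrite /=; lra.
apply: filterS2 h1 h2 => i /negP; rewrite -ltNge => h1 /negP.
by rewrite -ltNge => h2; rewrite ltr_norml; apply/andP; split; lra.
Qed.

(** * A countable separating family of functionals *)

(** The linear functionals of dual norm at most [1]. *)
Definition functional_unit_ball (R : realType) (X : normedModType R)
    (f : {linear X -> R^o}) : Prop := forall z, `|f z| <= `|z|.

Lemma functional_unit_ball_continuous (R : realType) (X : normedModType R)
    (f : {linear X -> R^o}) : functional_unit_ball f -> continuous f.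
Proof.
move=> cf; apply: bounded_linear_continuous; apply/linear_boundedP.
near=> r => z; rewrite (le_trans (cf z))// ler_peMl//.
Unshelve. all: by end_near. Qed.

(** Up to a factor [2], some functional of norm at most [1] is maximal at [y]
    among all of them.  It plays the role of a norming functional: the supremum
    over the dual ball is used instead of [|y|], so that the Hahn-Banach theorem
    is not needed. *)
Lemma almost_norming_functional (R : realType) (X : normedModType R) (y : X) :
  exists2 f : {linear X -> R^o}, functional_unit_ball f &
    forall g : {linear X -> R^o}, functional_unit_ball g -> g y <= 2 * f y.
Proof.
pose E : set R := [set t | exists2 g : {linear X -> R^o},
  functional_unit_ball g & g y = t].
have E0 : E 0.
  by exists (\0 : {linear X -> R^o}) => // z; rewrite normr0.
have ubE : has_ubound E.
  by exists `|y| => _ [g cg <-]; exact: le_trans (ler_norm _) (cg y).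
have supE : has_sup E by split => //; exists 0.
have := ub_le_sup ubE E0; rewrite le_eqVlt => /predU1P[s0|s0].
  exists (\0 : {linear X -> R^o}); first by move=> z; rewrite normr0.
  move=> g cg; rewrite mulr0 s0; apply: ub_le_sup => //; by exists g.
have s2 : 0 < sup E / 2 by rewrite divr_gt0.
have [_ [f cf <-] sf] := sup_adherent s2 supE.
exists f => // g cg.
have : g y <= sup E by apply: ub_le_sup => //; exists g.
lra.
Qed.

(** The point described by a binary tree whose leaves are terms of [u] and whose
    nodes stand for midpoints.  Trees are encoded in [GenTree.tree nat], which is
    countable; the nodes which are not binary get the value [0]. *)
Fixpoint midpoint_eval (R : realType) (X : normedModType R) (u : nat -> X)
    (t : GenTree.tree nat) : X :=
  match t with
  | GenTree.Leaf n => u n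
  | GenTree.Node _ [:: s; t] =>
      2^-1 *: (midpoint_eval u s + midpoint_eval u t)
  | _ => 0
  end.

(** Every sequence is contained in a countable set stable under midpoints. *)
Lemma countable_midpoint_closed (R : realType) (X : normedModType R)
    (u : nat -> X) :
  exists2 q : nat -> X, (forall n, range q (u n)) & midconvex (range q).
Proof.
pose q k := midpoint_eval u (odflt (GenTree.Leaf 0%N) (unpickle k)).
have qE t : q (pickle t) = midpoint_eval u t by rewrite /q pickleK.
exists q => [n|_ _ [i _ <-] [j _ <-]]; first by exists (pickle (GenTree.Leaf n)).
by exists (pickle (GenTree.Node 0%N [:: odflt (GenTree.Leaf 0%N) (unpickle i);
   odflt (GenTree.Leaf 0%N) (unpickle j)])) => //.
Qed.

Lemma midconvex_closure (R : realType) (X : normedModType R) (D : set X) :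
  midconvex D -> midconvex (closure D).
Proof.
move=> mD y z cy cz B /nbhs_ballP[e /= e0 eB].
have [y' [Dy' yy']] := cy _ (nbhsx_ballx y e e0).
have [z' [Dz' zz']] := cz _ (nbhsx_ballx z e e0).
exists (2^-1 *: (y' + z')); split; first exact: mD.
apply: eB; move: yy' zz'; rewrite -!ball_normE /= => yy' zz'.
rewrite -scalerBr opprD addrACA normrZ gtr0_norm ?invr_gt0// ltr_pdivrMl//.
by rewrite (le_lt_trans (ler_normD _ _))//; lra.
Qed.

(** On some closed convex set [Y] containing the sequence [u], points at which
    all the terms of a sequence [f] of continuous functionals agree are not
    separated by any continuous functional.
    [Y] is the closure of a countable set [d], and the [f j] are the almost
    norming functionals of the differences of elements of [d]. *)
Lemma separating_functionals (R : realType) (X : normedModType R)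
    (u : nat -> X) :
  exists f : nat -> {linear X -> R^o}, exists Y : set X,
    [/\ forall j, continuous (f j), closed Y, midconvex Y, forall n, Y (u n) &
     forall p q, Y p -> Y q -> (forall j, f j p = f j q) ->
     forall g : {linear X -> R^o}, continuous g -> g p = g q].
Proof.
have [d du md] := countable_midpoint_closed u.
have /choice[h Hh] : forall y : X, exists f : {linear X -> R^o},
    functional_unit_ball f /\
    forall g : {linear X -> R^o}, functional_unit_ball g -> g y <= 2 * f y.
  by move=> y; have [f ? ?] := almost_norming_functional y; exists f.
(* Every pair of indices occurs as [idx k], for [k := pickle (i, j)]. *)
pose idx k : nat * nat := odflt (0%N, 0%N) (unpickle k).
exists (fun k => h (d (idx k).1 - d (idx k).2)), (closure (range d)); split.
- by move=> k; apply: functional_unit_ball_continuous; exact: (Hh _).1.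
- exact: closed_closure.
- exact: midconvex_closure.
- by move=> n; exact: subset_closure.
have key (g : {linear X -> R^o}) p q : functional_unit_ball g ->
    closure (range d) p -> closure (range d) q ->
    (forall k, h (d (idx k).1 - d (idx k).2) p =
               h (d (idx k).1 - d (idx k).2) q) -> g p <= g q.
  move=> cg Yp Yq hpq; apply/ler_addgt0Pr => e e0.
  (* Let [d i] and [d j] be within [e / 6] of [p] and [q].  As [f p = f q] for
     the functional [f] associated with [d i - d j], [f (d i - d j) <= e / 3];
     hence [g (d i - d j) <= 2 * (e / 3)] and [g (p - q) <= e]. *)
  have e6 : 0 < e / 6 by rewrite divr_gt0.
  have [_ [[i _ <-]]] := Yp _ (nbhsx_ballx p _ e6).
  rewrite -ball_normE /= => pi.
  have [_ [[j _ <-]]] := Yq _ (nbhsx_ballx q _ e6).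
  rewrite -ball_normE /= => qj.
  have := hpq (pickle (i, j)); rewrite /idx pickleK /=.
  have [] := Hh (d i - d j); set f := h _ => cf /(_ _ cg) gf fpq.
  move: gf; rewrite !linearB.
  have := le_lt_trans (cg _) pi; have := le_lt_trans (cg _) qj.
  have := le_lt_trans (cf _) pi; have := le_lt_trans (cf _) qj.
  rewrite !linearB !ltr_norml fpq.
  move=> /andP[? ?] /andP[? ?] /andP[? ?] /andP[? ?]; lra.
(* A continuous functional is a positive multiple of one of norm at most [1]. *)
have key2 (g : {linear X -> R^o}) p q : continuous g ->
    closure (range d) p -> closure (range d) q ->
    (forall k, h (d (idx k).1 - d (idx k).2) p =
               h (d (idx k).1 - d (idx k).2) q) -> g p <= g q.
  move=> /linear_bounded_continuous/linear_boundedP/pinfty_ex_gt0[K K0 gK].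
  move=> Yp Yq hpq.
  have := key (K^-1 \*: g : {linear X -> R^o}) p q _ Yp Yq hpq.
  rewrite /= -[_ *: g p]/(_ * _) -[_ *: g q]/(_ * _) ler_pM2l ?invr_gt0//; apply.
  move=> z /=; rewrite normrZ gtr0_norm ?invr_gt0// ler_pdivrMl//.
move=> p q Yp Yq hpq g cg; apply/eqP; rewrite eq_le; apply/andP; split.
- exact: key2.
- by apply: key2.
Qed.

(** * Weakly convergent subsequences *)

Lemma cvg_nat_of_ge (phi : nat -> nat) :
  (forall k, (k <= phi k)%N) -> phi k @[k --> \oo] --> \oo.
Proof.
move=> kphi A [N _ NA]; exists N => // k /= Nk; apply: NA => /=.
exact: leq_trans (kphi k).
Qed.

(** Subsequences are given by maps [psi] with [k <= psi k], which is all that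
    passing to the limit requires; [psi] need not be increasing. *)
Lemma not_near_subsequence (P : set nat) :
  ~ (\forall n \near \oo, P n) ->
  exists2 psi : nat -> nat, (forall k, (k <= psi k)%N) & forall k, ~ P (psi k).
Proof.
move=> nP.
have /choice[psi Hpsi] : forall k, exists n, (k <= n)%N /\ ~ P n.
  move=> k; apply: contrapT => nk; apply: nP; exists k => // n /= kn.
  by apply: contrapT => nPn; apply: nk; exists n.
by exists psi => k; have [] := Hpsi k.
Qed.

(** Weak sequential compactness of bounded closed convex sets in uniformly convex
    Banach spaces, in the manner of the Eberlein-Smulian theorem. *)
Lemma uniformly_convex_weak_subsequence (R : realType)
    (X : completeNormedModType R) (u : nat -> X) (M : R) :
  uniformly_convex X -> (forall n, `|u n| <= M) ->
  exists phi : nat -> nat, exists p,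
    [/\ forall k, (k <= phi k)%N, weak_cvg (u \o phi) p &
     forall D, closed D -> midconvex D -> (forall n, D (u n)) -> D p].
Proof.
move=> ucX uM.
have [f [Y [cf cY mY Yu Ysep]]] := separating_functionals u.
have [U [UU ooU]] := ultraFilterLemma eventually_filter.
have [p Dp fp] := uniformly_convex_ultra_weak_cvg ucX UU uM.
(* The weak limit [p] along [U] is approached by [u (phi k)], up to [1 / (k + 1)],
   on the first [k] functionals of the separating family. *)
have /choice[phi Hphi] : forall k, exists n, (k <= n)%N /\
    forall j : 'I_k, `|f j p - f j (u n)| < k.+1%:R^-1.
  move=> k.
  suff : \forall n \near U, (k <= n)%N /\
      forall j : 'I_k, `|f j p - f j (u n)| < k.+1%:R^-1.
    by move/filter_ex.
  apply: filterI; first by apply: ooU; exists k.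
  apply: filter_forall => j.
  by have /cvgrPdist_lt := fp (f j) (cf j); apply; rewrite invr_gt0.
exists phi, p; split => [k||//]; first by have [] := Hphi k.
move=> g cg; apply/cvgrPdist_lt => e e0; apply: contrapT.
move=> /not_near_subsequence[psi kpsi Hpsi].
(* A weak limit [q] of the terms that stay [e]-far from [p] on [g] agrees with
   [p] on the whole separating family, hence also on [g]. *)
have [V [VV ooV]] := ultraFilterLemma eventually_filter.
pose v := u \o phi \o psi.
have [|q Dq fq] := @uniformly_convex_ultra_weak_cvg _ _ _ _ v M ucX VV.
  by move=> k; exact: uM.
have fpq j : f j p = f j q.
  have hq : f j (v k) @[k --> V] --> f j q by exact: fq.
  suff hp : f j (v k) @[k --> V] --> f j p.
    exact: norm_cvg_unique hp hq.
  suff : f j (v k) @[k --> \oo] --> f j p.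
    by move=> ooj; apply: cvg_trans ooj => A; exact: ooV.
  apply: (@cvg_comp _ _ _ psi (f j \o u \o phi) _ _ _ (cvg_nat_of_ge kpsi)).
  apply/cvgrPdist_lt => r r0; near=> k.
  have jk : (j < k)%N by near: k; exact: nbhs_infty_gt.
  apply: lt_trans ((Hphi k).2 (Ordinal jk)) _.
  near: k; exact: (near_infty_natSinv_lt (PosNum r0)).
have gpq : g p = g q.
  by apply: (Ysep p q) => //; [exact: Dp|apply: Dq => // k; exact: Yu].
have /cvgrPdist_lt/(_ _ e0) := fq g cg.
by rewrite -gpq => /filter_ex[k /(Hpsi k)].
Unshelve. all: by end_near. Qed.

(** * Nonexpansive maps *)

(** [T] is nonexpansive on [C]; its values outside [C] play no role. *)
Definition nonexpansive_on (R : realType) (X : normedModType R) (C : set X)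
    (T : X -> X) : Prop :=
  forall y z, C y -> C z -> `|T y - T z| <= `|y - z|.

Lemma near_residual (R : realType) (X : normedModType R) (C : set X)
    (T : X -> X) (u : nat -> X) (p : X) :
  nonexpansive_on C T -> C p -> (forall n, C (u n)) ->
  `|u n - T (u n)| @[n --> \oo] --> (0 : R) ->
  forall eta : R, 0 < eta ->
    \forall n \near \oo, `|u n - T p| <= `|u n - p| + eta.
Proof.
move=> Tn Cp Cu /cvgrPdist_lt res eta eta0.
apply: filterS (res _ eta0) => n; rewrite sub0r normrN normr_id => rn.
rewrite (le_trans (ler_distD (T (u n)) _ _))// addrC lerD//; last exact: ltW.
exact: Tn.
Qed.

(** The distance of the iterates to any fixed point converges. *)
Lemma krasnoselskii_mann_fejer (R : realType) (X : normedModType R)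
    (C : set X) (T : X -> X) (alpha : nat -> R) (e x : nat -> X) (p : X) :
  nonexpansive_on C T -> (forall n, (1 <= n)%N -> 0 <= alpha n <= 1) ->
  (forall n, C (x n)) ->
  (forall n, x n.+1 =
     (1 - alpha n.+1) *: x n + alpha n.+1 *: (T (x n) + e n.+1)) ->
  (\sum_(1 <= k <oo) (alpha k * `|e k|)%:E < +oo)%E ->
  fix_points C T p -> cvgn (fun n => `|x n - p|).
Proof.
move=> Tn a01 Cx xS esum [Cp Tp].
apply: (@quasi_fejer_cvg _ _ (fun k => alpha k * `|e k|)) => // n.
  by rewrite mulr_ge0//; have /andP[] := a01 n.+1 isT.
have /andP[a0 a1] := a01 n.+1 isT; set a := alpha _ in a0 a1 *.
rewrite xS -/a.
have -> : (1 - a) *: x n + a *: (T (x n) + e n.+1) - p =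
    (1 - a) *: (x n - p) + a *: (T (x n) - T p) + a *: e n.+1.
  rewrite Tp !scalerBr scalerDr addrACA -opprD -scalerDl subrK scale1r.
  by rewrite addrA [LHS]addrAC.
rewrite (le_trans (ler_normD _ _))// [X in _ + X]normrZ (ger0_norm a0) lerD2r.
rewrite (le_trans (ler_normD _ _))// !normrZ (ger0_norm a0) ger0_norm ?subr_ge0//.
have := ler_wpM2l a0 (Tn _ _ (Cx n) Cp).
lra.
Qed.

(** * Consequences of Opial's property *)

Lemma limn_einf_le (R : realType) (a b : nat -> \bar R) :
  (\forall n \near \oo, (a n <= b n)%E) -> (limn_einf a <= limn_einf b)%E.
Proof.
move=> [N _ ab]; rewrite !limn_einf_lim.
apply: lee_lim; [exact: is_cvg_einfs|exact: is_cvg_einfs|].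
exists N => // n /= Nn; apply: le_ereal_inf_tmp => _ [k /= nk <-].
apply: le_trans (ab k (leq_trans Nn nk)).
by apply: ereal_inf_lbound; exists k.
Qed.

(** Demiclosedness at the origin of the difference of the identity and [T]: a weak
    limit [p] of approximate fixed points is a fixed point.  Otherwise Opial's
    property would make [T p] asymptotically farther from the sequence than [p],
    against [near_residual]. *)
Lemma opial_demiclosed (R : realType) (X : normedModType R) (C : set X)
    (T : X -> X) (u : nat -> X) (p : X) :
  opial X -> nonexpansive_on C T -> C p -> (forall n, C (u n)) ->
  `|u n - T (u n)| @[n --> \oo] --> (0 : R) -> weak_cvg u p -> T p = p.
Proof.
move=> opX Tn Cp Cu res up; apply: contrapT => /(opX _ _ up).
rewrite ltNge => /negP; apply; apply/lee_addgt0Pr => eta eta0.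
rewrite addeC -limn_einf_shift//; apply: limn_einf_le.
apply: filterS (near_residual Tn Cp Cu res eta0) => n.
by rewrite -EFinD lee_fin (addrC eta).
Qed.

(** If the distances of [x] to [p] and [q] converge and [p] is a weak limit of a
    subsequence of [x], the limit distance to [p] is the smaller one. *)
Lemma opial_lt (R : realType) (X : normedModType R) (x : nat -> X)
    (phi : nat -> nat) (p q : X) (a b : R) :
  opial X -> phi k @[k --> \oo] --> \oo -> weak_cvg (x \o phi) p -> q <> p ->
  `|x n - p| @[n --> \oo] --> a -> `|x n - q| @[n --> \oo] --> b -> a < b.
Proof.
move=> opX phioo xp qp xa xb.
have lim_phi y c : `|x n - y| @[n --> \oo] --> c ->
    limn_einf (fun k => (`|(x \o phi) k - y|)%:E) = c%:E.
  move=> xc.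
  suff /cvg_limn_einf_sup[] : (`|(x \o phi) k - y|)%:E @[k --> \oo] --> c%:E.
    by [].
  apply: cvg_EFin; first exact: nearW.
  exact: (cvg_comp phi (fun n => `|x n - y|) phioo xc).
by have := opX _ _ xp _ qp; rewrite (lim_phi _ _ xa) (lim_phi _ _ xb) lte_fin.
Qed.

(** * Strong convergence under compactness *)

(** A cluster point of the sequence [T (x n)] is a fixed point of [T], and also a
    cluster point of [x], which is what the second part of the conclusion says. *)
Lemma precompact_fixed_point (R : realType) (X : normedModType R) (C : set X)
    (T : X -> X) (x : nat -> X) :
  closed C -> nonexpansive_on C T -> (forall n, C (x n)) ->
  `|x n - T (x n)| @[n --> \oo] --> (0 : R) -> precompact (T @` C) ->
  exists2 p, fix_points C T p &
    forall (eps : R) N, 0 < eps -> exists2 n, (N <= n)%N & `|x n - p| < eps.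
Proof.
move=> cC Tn Cx res; rewrite precompactE => cptT.
have TxK : ((T \o x) @ \oo) (closure (T @` C)).
  by exists 0%N => // n _; apply: subset_closure; exists (x n).
have [p [_ clp]] := cptT _ _ TxK.
have freq (eps : R) N : 0 < eps -> exists2 n, (N <= n)%N &
    `|x n - T (x n)| < eps /\ `|x n - p| < eps.
  move=> eps0; have e2 : 0 < eps / 2 by rewrite divr_gt0.
  pose P n := (N <= n)%N /\ `|x n - T (x n)| < eps / 2.
  have PF : ((T \o x) @ \oo) ((T \o x) @` P).
    have : \forall n \near \oo, P n.
      apply: filterI; first by exists N.
      move/cvgrPdist_lt : res => /(_ _ e2); apply: filterS => n.
      by rewrite sub0r normrN normr_id.
    by apply: filterS => n Pn; exists n.
  have [_ [[n [Nn rn] <-]]] := clp _ _ PF (nbhsx_ballx p _ e2).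
  rewrite -ball_normE /= => pn; exists n => //; split; first by lra.
  rewrite (le_lt_trans (ler_distD (T (x n)) _ _))//.
  by rewrite (distrC p) in pn; lra.
exists p; last by move=> eps N /(freq _ N)[n Nn [_ ?]]; exists n.
have Cp : C p.
  apply: cC => B /nbhs_ballP[eps /= eps0 epsB].
  have [n _ [_ xp]] := freq _ 0%N eps0.
  by exists (x n); split => //; apply: epsB; rewrite -ball_normE /= distrC.
split => //; apply/eqP; rewrite -subr_eq0 -normr_le0; apply/ler_addgt0Pr => e e0.
have e3 : 0 < e / 3 by rewrite divr_gt0.
have [n _ [rn xp]] := freq _ 0%N e3.
have := Tn _ _ Cp (Cx n).
have := ler_distD (T (x n)) (T p) p; have := ler_distD (x n) (T (x n)) p.
rewrite (distrC p) (distrC (T (x n)) (x n)); lra.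
Qed.

Lemma dist_cvg_of_frequently (R : realType) (X : normedModType R)
    (x : nat -> X) (p : X) :
  cvgn (fun n => `|x n - p|) ->
  (forall (eps : R) N, 0 < eps -> exists2 n, (N <= n)%N & `|x n - p| < eps) ->
  x n @[n --> \oo] --> p.
Proof.
move=> /cvg_ex[l xl] freq.
suff l0 : l = 0.
  apply/cvgrPdist_lt => eps eps0; move: xl; rewrite l0 => /cvgrPdist_lt/(_ _ eps0).
  by apply: filterS => n; rewrite sub0r normrN normr_id distrC.
apply/eqP; rewrite -normr_le0; apply/ler_addgt0Pr => e e0; rewrite add0r.
have e2 : 0 < e / 2 by rewrite divr_gt0.
have /cvgrPdist_lt/(_ _ e2)[N _ lN] := xl.
have [n Nn xn] := freq _ N e2.
have := lN n Nn; have := ler_normD (l - `|x n - p|) `|x n - p|.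
rewrite subrK normr_id; lra.
Qed.

(** * Convergence of the iterates *)

Theorem theorem2p4 (R : realType) (X : completeNormedModType R)
    (C : set X) (T : {fun C >-> C})
    (alpha : nat -> R) (e : nat -> X) (x : nat -> X)
    (C_closed : closed C)
    (C_convex : convex_set (C : set (convex_lmodType X)))
    (T_nonexpansive : 1.-lipschitz_C T)
    (alpha01 : forall n : nat, (1 <= n)%N -> 0 <= alpha n <= 1)
    (xC : forall n : nat, C (x n))
    (x_rec : forall n : nat,
       x n.+1 = (1 - alpha n.+1) *: x n + alpha n.+1 *: (T (x n) + e n.+1))
    (x_residual : `|x n - T (x n)| @[n --> \oo] --> (0 : R))
    (e_summable : (\sum_(1 <= k <oo) (alpha k * `|e k|)%:E < +oo)%E) :
  (precompact (T @` C) ->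
     exists2 p : X, fix_points C T p & x n @[n --> \oo] --> p)
  /\
  (uniformly_convex X -> bounded_fun x ->
     fix_points C T !=set0 /\
     (opial X -> exists2 p : X, fix_points C T p & weak_cvg x p)).
Proof.
have Tn : nonexpansive_on C T.
  move=> y z Cy Cz; have /= := T_nonexpansive (y, z) (conj Cy Cz).
  by rewrite mul1r.
have fejer p : fix_points C T p -> cvgn (fun n => `|x n - p|).
  exact: (krasnoselskii_mann_fejer Tn alpha01 xC x_rec e_summable).
split.
  move=> /(precompact_fixed_point C_closed Tn xC x_residual)[p Fp freq].
  by exists p => //; apply: dist_cvg_of_frequently => //; exact: fejer.
move=> ucX /pinfty_ex_gt0[M _ xM'].
have xM n : `|x n| <= M by exact: xM'.
have mC := convex_set_midconvex C_convex.
split.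
  have C0 : C !=set0 by exists (x 0%N).
  have [c Cc cuniq] := asymptotic_center ucX C_closed mC C0 xM.
  exists c; split => //; apply: cuniq; first exact: funS.
  exact: (near_residual Tn Cc xC x_residual).
move=> opX.
(* Every subsequence of [x] has a subsequence which converges weakly to a fixed
   point. *)
have sub psi : (forall k, (k <= psi k)%N) -> exists theta : nat -> nat,
    exists p, [/\ forall k, (k <= theta k)%N, fix_points C T p &
                  weak_cvg (x \o psi \o theta) p].
  move=> psik.
  have [|theta [p [thetak xp Cp]]] :=
    @uniformly_convex_weak_subsequence _ _ (x \o psi) M ucX _.
    by move=> k; exact: xM.
  have {}Cp : C p by apply: Cp => // k; exact: xC.
  exists theta, p; split => //; split => //.
  apply: (opial_demiclosed opX Tn Cp _ _ xp) => [k|]; first exact: xC.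
  apply: (@cvg_comp _ _ _ (psi \o theta) (fun n => `|x n - T (x n)|)
           _ _ _ _ x_residual).
  by apply: cvg_nat_of_ge => k /=; exact: leq_trans (thetak k) (psik _).
have [phi [p [phik Fp xp]]] := sub id (fun k => leqnn k).
exists p => // f cf; apply/cvgrPdist_lt => eps eps0; apply: contrapT.
move=> /not_near_subsequence[psi psik far].
have [theta [q [thetak Fq xq]]] := sub psi psik.
have [qp|/eqP qp] := eqVneq q p.
  have /cvgrPdist_lt/(_ _ eps0) := xq f cf.
  by rewrite qp => /filter_ex[k]; exact: far.
have /cvg_ex[a xa] := fejer p Fp; have /cvg_ex[b xb] := fejer q Fq.
have phioo := cvg_nat_of_ge phik.
have ptoo := @cvg_nat_of_ge (psi \o theta)
  (fun k => leq_trans (thetak k) (psik _)).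
have := opial_lt opX phioo xp qp xa xb.
have := opial_lt opX ptoo xq (fun pq => qp (esym pq)) xb xa.
by move=> /lt_trans h /h; rewrite ltxx.
Qed.
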